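(* Let $0<\lambda\le \frac12$ and define $(q_k)_{k\ge1}$ by $$q_1=1-\lambda(1-\lambda),\qquad q_k=1-\frac{(\lambda(1-\lambda))^k}{\prod_{j=1}^{k-1}q_j^{2(k-j)}},\quad k\ge2,$$ with the convention $q_0:=0$. Construct a random finite rooted planar tree as follows. (1) Choose a random maximal generation $M$ with law $$\mathbb P(M=m)=(1-q_m)\prod_{\ell>m}q_\ell,\qquad m\ge0.$$ If $M=0$ the tree consists of the root only. (2) Given $M=m\ge1$, attach directly to the root a number of $m$-branches distributed as a Geometric$(q_m)$ random variable conditioned to be strictly positive. (3) Iteratively for $k=m-1,m-2,\dots,1$: given the tree formed by the root and all the attached branches of size bigger than $k$, attach to each of the $k$-slots$^*$ of this tree a number of $k$-branches, these numbers being (conditionally on the tree) independent Geometric$(q_k)$ random variables. Then the random tree obtained is a branching process with offspring distribution Geometric$(1-\lambda)$, i.e. it has the same law as the random rooted planar tree of a branching process started from one individual (the root) in which all individuals have independent numbers of children with distribution $\rho(k)=(1-\lambda)\lambda^k$, $k=0,1,2,\dots$.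
   Context: **Geometric law.** A Geometric$(q)$ random variable takes value $k\in\{0,1,2,\dots\}$ with probability $q(1-q)^k$. **Branching process.** The branching process with offspring distribution $\rho$ is the random rooted planar tree in which, starting from the root, each vertex of each generation independently has a random number of children with law $\rho$, the children being ordered from left to right. **Branches.** A $k$-branch is a path of $k$ nodes (with an edge joining its top node to a node of the tree it is attached to). **Height.** In a finite rooted planar tree, a leaf (non-root node without children) has height $1$ and any other non-root node has height one plus the maximal height of its children. **Slots$^*$.** Let $k\ge1$ and let $\mathcal T$ be the planar tree formed by the root and branches all of size bigger than $k$ attached by the procedure in the claim. Draw each node of $\mathcal T$ as a circle, with its incident edges meeting the circle at distinct points: the edge to its parent from below (by convention the root also has an edge incident from below) and the edges to its children ordered from left to right (clockwise). A node with $c$ children has $c+1$ arcs between consecutive incident points, called slots$^*$. A slot$^*$ $\mathtt s$ is a $k$-slot$^*$ if one of the following holds: (a) $\mathtt s$ belongs to the root; (b) $\mathtt s$ belongs to a node that has more than $k$ generations of descendants in $\mathcal T$ (height larger than $k+1$); (c) $\mathtt s$ belongs to a node having exactly $k$ generations of descendants in $\mathcal T$ (height $k+1$), and every path with $k$ nodes that starts at a child of that node and descends to a leaf is incident to the node to the right of $\mathtt s$. **Attaching.** Attaching $r$ $k$-branches to a $k$-slot$^*$ $\mathtt s$ of a node $v$ means adding $r$ disjoint paths of $k$ new nodes each, placed side by side, the top node of each being joined to $v$ by an edge meeting the circle of $v$ inside the arc $\mathtt s$, each further node of the path being the unique child of the previous one. *)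

(* Defs.v *)
(* MathComp / MathComp-Analysis. *)
From HB Require Import structures.
From mathcomp Require Import all_boot all_order all_algebra.
From mathcomp Require Import all_classical all_reals all_analysis.

Set Implicit Arguments.
Unset Strict Implicit.
Unset Printing Implicit Defensive.

Import Order.TTheory GRing.Theory Num.Theory.
Import numFieldNormedType.Exports.

Local Open Scope classical_set_scope.
Local Open Scope ring_scope.

(* Finite rooted planar trees: a node is given by its children, listed from
   left to right. *)
Inductive tree := Node of seq tree.

Definition children (t : tree) : seq tree := let: Node ts := t in ts.

(* Nodes are addressed by words: [::] is the root, rcons u i is the i-th child
   (counted from 0) of u.  The result is None if u is not a node of t. *)
Fixpoint subtree (t : tree) (u : seq nat) : option tree :=
  if u is i :: u' then
    if onth (children t) i is Some t' then subtree t' u' else None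
  else Some t.

Definition nodes (t : tree) : set (seq nat) := [set u | isSome (subtree t u)].

Fixpoint height (t : tree) : nat :=
  let: Node ts := t in (foldr maxn 0 (map height ts)).+1.

(* There is a path with k nodes starting at the root of t and descending to a
   childless node. *)
Fixpoint leaf_path (k : nat) (t : tree) : bool :=
  match k with
  | 0 => false
  | 1 => nilp (children t)
  | k'.+1 => has (leaf_path k') (children t)
  end.

(* The pair (u, j) stands for the j-th arc of the node u, numbered clockwise
   from the parent edge: a node with c children has the arcs 0, ..., c, where
   arc 0 precedes the leftmost child, arc c follows the rightmost one, and
   the children lying to the right of arc j are those of index at least j. *)
Definition slot : Type := (seq nat * nat)%type.

Definition is_kslot (k : nat) (t : tree) (s : slot) : bool :=
  let: (u, j) := s in
  if subtree t u is Some v then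
    (j <= size (children v))%N &&
    [|| u == [::],
        (k.+1 < height v)%N
      | (height v == k.+1) &&
        all (fun i => leaf_path k (nth (Node [::]) (children v) i) ==> (j <= i)%N)
            (iota 0 (size (children v)))]
  else false.

(* The path with k nodes, for k >= 1. *)
Definition branch (k : nat) : tree :=
  iter k.-1 (fun t => Node [:: t]) (Node [::]).

(* Inserts the list of trees b (u, j) in every arc (u, j) of t; here u0 is the
   address of (the root of) t in the ambient tree. *)
Fixpoint insert_at (b : slot -> seq tree) (u0 : seq nat) (t : tree) : tree :=
  let: Node ts := t in
  Node ((fix weave (j : nat) (ts : seq tree) : seq tree :=
           if ts is t' :: ts' then
             b (u0, j) ++ insert_at b (rcons u0 j) t' :: weave j.+1 ts'
           else b (u0, j)) 0%N ts).

(* Attaches n s k-branches to each k-slot s of t; the values of n outside the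
   k-slots are ignored. *)
Definition attach (k : nat) (n : slot -> nat) (t : tree) : tree :=
  insert_at (fun s => nseq (if is_kslot k t s then n s else 0%N) (branch k))
            [::] t.

Section Laws.
Variable R : realType.

Definition geom (q : R) (k : nat) : R := q * (1 - q) ^+ k.

(* Geometric(q) conditioned to be strictly positive. *)
Definition geom_pos (q : R) (k : nat) : R :=
  if k is 0 then 0 else geom q k / (1 - geom q 0).

(* The infinite product over l > m is the limit of its partial products. *)
Definition max_gen_law (q : nat -> R) (m : nat) : R :=
  (1 - q m) * limn (fun n => \prod_(m.+1 <= l < n) q l).

(* Conditionally on the event E, the nat-valued random variables X i, i in S,
   are independent with common law rho.  As they are discrete, this is the
   product formula for the joint mass function of every finite subfamily;
   multiplying by P E avoids dividing by 0 when E is negligible. *)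
Definition iid_given d (Omega : measurableType d) (P : probability Omega R)
    (E : set Omega) (I : eqType) (S : set I) (X : I -> {RV P >-> nat})
    (rho : nat -> R) : Prop :=
  forall (s : seq I) (n : I -> nat), uniq s -> [set` s] `<=` S ->
    P (E `&` [set w | forall i, i \in s -> X i w = n i]) =
    (P E * (\prod_(i <- s) rho (n i))%:E)%E.

(* One realization of the random construction on a probability space:
   M is the maximal generation, B the number of M-branches attached to the
   root, C k s the number of k-branches attached to the slot s, and Tr k the
   tree formed by the root and the branches of size at least k, so that Tr 1 is
   the tree finally obtained. *)
Record construction (q : nat -> R) d (Omega : measurableType d)
    (P : probability Omega R) (M B : {RV P >-> nat})
    (C : nat -> slot -> {RV P >-> nat}) (Tr : nat -> Omega -> tree) : Prop := {
  law_M : forall m : nat, P [set w | M w = m] = (max_gen_law q m)%:E;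
  Tr_root : forall w, M w = 0%N -> Tr 1%N w = Node [::];
  law_B : forall m r : nat, (0 < m)%N ->
    P [set w | M w = m /\ B w = r] =
    (P [set w | M w = m] * (geom_pos (q m) r)%:E)%E;
  Tr_max : forall w, (0 < M w)%N ->
    Tr (M w) w = Node (nseq (B w) (branch (M w)));
  law_C : forall (m k : nat) (t : tree), (0 < k < m)%N ->
    iid_given [set w | M w = m /\ Tr k.+1 w = t] [set s | is_kslot k t s]
      (C k) (geom (q k));
  Tr_step : forall w k, (0 < k < M w)%N ->
    Tr k w = attach k (fun s => C k s w) (Tr k.+1 w)
}.

(* Set of nodes of the (possibly infinite) genealogical tree in which the
   potential individual u has N u children. *)
Definition genealogy (N : seq nat -> nat) : set (seq nat) :=
  [set u | forall i, (i < size u)%N -> (nth 0%N u i < N (take i u))%N].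

End Laws.

(* Main.v *)
Require Import Defs.
From HB Require Import structures.
From mathcomp Require Import all_boot all_order all_algebra.
From mathcomp Require Import all_classical all_reals all_analysis.
From mathcomp Require Import zify ring lra.

Set Implicit Arguments.
Unset Strict Implicit.
Unset Printing Implicit Defensive.

Import Order.TTheory GRing.Theory Num.Theory.
Import numFieldNormedType.Exports.

Local Open Scope classical_set_scope.
Local Open Scope ring_scope.

(** Write [x = lambda * (1 - lambda)]. Under the branching process a finite tree
with [e] edges has mass [(1 - lambda) * x ^+ e] ([genealogy_law]), so the point
is that the construction gives every tree at most this mass ([law_Tr1]). This is
enough: an inequality between the masses of all trees gives an inequality
between the probabilities of a set of trees and of its complement, and the
constructed tree has total mass one ([law_eq_of_le]). The surjectivity of the
construction and the extinction of the branching process follow.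

The bound rests on two combinatorial facts. First, the construction is
injective: a tree obtained by attaching [k]-branches to a tree made of longer
branches determines both that tree and the number of branches in each slot
([attach_inj]). Hence the probability of a tree is at most a product, with a
factor [q k] for each [k]-slot and a factor [1 - q k] for each [k]-branch.
Second, attaching one [k]-branch adds [k] edges and, for each [l < k], creates
exactly [2 * (k - l)] new [l]-slots ([edges_attach], [nslots_attach]). The
definition of [q] says precisely that [1 - q k] times the product of
[q l ^+ (2 * (k - l))] over [l < k] is [x ^+ k], so that each [k]-branch
contributes [x ^+ k] altogether, and the whole product is [x ^+ e] times the
product of all [q l]. These bookkeeping identities are packaged in the weight
[tree_weight], whose evolution is [tree_weight_attach].

Finally the infinite product equals [1 - lambda] ([cvg_pprod]): the partial
products satisfy [p n.+1 = 1 - x / p n] and decrease to the fixed point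
[1 - lambda]. The same recursion shows that [0 < q k < 1] and makes the sum of
the law of the maximal generation telescope. *)

(** * Trees, grafting and interleaved lists *)

Local Open Scope nat_scope.

Fixpoint encode (t : tree) : GenTree.tree unit :=
  let: Node ts := t in GenTree.Node 0 (map encode ts).

Fixpoint decode (g : GenTree.tree unit) : tree :=
  if g is GenTree.Node _ gs then Node (map decode gs) else Node [::].

(** The generated induction principle gives no hypothesis on the children;
here they are accessed by index, since addresses are lists of indices. *)
Lemma tree_ind_nth (Q : tree -> Prop) :
  (forall ts, (forall i, (i < size ts)%N -> Q (nth (Node [::]) ts i)) ->
     Q (Node ts)) ->
  forall t, Q t.
Proof.
move=> IH; fix rec 1 => -[ts]; apply: IH.
elim: ts => [i|t ts IHts [_|i]]; first by clear rec.
  exact: (rec t).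
by clear rec; exact: (IHts i).
Qed.

Lemma encodeK : cancel encode decode.
Proof.
elim/tree_ind_nth => ts IH /=; congr Node.
rewrite -map_comp; apply: (@eq_from_nth _ (Node [::])); rewrite size_map // => i iS.
by rewrite (nth_map (Node [::])) //= IH.
Qed.

(** Countability is what reduces the equality of two laws on trees to
inequalities between the masses of single trees. *)
HB.instance Definition _ := Countable.copy tree (can_type encodeK).

(** The children of a node once [c j] copies of [x] have been put in its arc
[j]; there is one more arc than there are children. *)
Fixpoint weave (x : tree) (c : nat -> nat) (ts : seq tree) : seq tree :=
  if ts is t :: ts' then
    nseq (c 0%N) x ++ t :: weave x (fun j => c j.+1) ts'
  else nseq (c 0%N) x.


Local Notation kid := (nth (Node [::])).

(** The insertion underlying [attach], for arbitrary numbers of branches, so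
that it can be analysed in a subtree with address [u0] in the ambient tree. *)
Definition graft (k : nat) (c : slot -> nat) (u0 : seq nat) (t : tree) : tree :=
  insert_at (fun s => nseq (c s) (branch k)) u0 t.

Lemma graft_Node k c u0 ts :
  graft k c u0 (Node ts) =
  Node (weave (branch k) (fun j => c (u0, j))
          (mkseq (fun i => graft k c (rcons u0 i) (kid ts i)) (size ts))).
Proof.
rewrite /graft /=; congr Node.
match goal with |- ?G 0%N ts = _ => set F := G end.
have F1 j t l : F j (t :: l) =
  nseq (c (u0, j)) (branch k) ++ graft k c (rcons u0 j) t :: F j.+1 l by [].
have H : forall l j0, F j0 l = weave (branch k) (fun j => c (u0, j0 + j)%N)
  (mkseq (fun i => graft k c (rcons u0 (j0 + i)%N) (kid l i)) (size l)).
  elim => [|t l IHl] j0; first by rewrite /= addn0.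
  rewrite F1 IHl /mkseq /= addn0 -[1%N]addn0 iotaDl -map_comp.
  congr (_ ++ _ :: weave _ _ _).
  - by apply/funext => j; rewrite addnS.
  - by apply: eq_map => i /=; rewrite addnS.
exact: H ts 0%N.
Qed.

(** All statistics of a grafted tree (edges, heights, slots, degrees) are
computed with this identity, the operation being [addn] or [maxn]. *)
Lemma big_weave (A : Type) (idx : A) (op : Monoid.com_law idx) x c l
    (f : tree -> A) :
  \big[op/idx]_(t <- weave x c l) f t =
  op (\big[op/idx]_(i < \sum_(j < (size l).+1) c j) f x)
     (\big[op/idx]_(t <- l) f t).
Proof.
elim: l c => [|t l IHl] c /=.
  by rewrite big_nil Monoid.mulm1 big_nseq big_ord_recl big_ord0 addn0 -big_const_ord.
rewrite big_cat !big_cons /= IHl [in RHS]big_ord_recl /= big_nseq.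
rewrite !big_const_ord [in RHS]iterD.
have H n y : iter n (op (f x)) y = op (iter n (op (f x)) idx) y.
  by elim: n => [|n /= ->]; rewrite ?Monoid.mul1m // Monoid.mulmA.
by rewrite [in RHS]H -Monoid.mulmA [X in _ = op _ X]Monoid.mulmCA.
Qed.

Lemma size_weave x c l :
  size (weave x c l) = \sum_(j < (size l).+1) c j + size l.
Proof. by rewrite -[LHS]sum1_size big_weave sum_nat_const card_ord muln1 sum1_size. Qed.

Lemma mem_weave x c l t : t \in weave x c l -> t = x \/ t \in l.
Proof.
elim: l c => [|y l IHl] c /=; first by rewrite mem_nseq => /andP[_ /eqP]; left.
rewrite mem_cat mem_nseq inE => /or3P[/andP[_ /eqP]|/eqP->|/IHl[->|H]]; first by left.
- by right; rewrite mem_head.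
- by left.
- by right; rewrite inE H orbT.
Qed.

Lemma weave0 x c l : (forall j, (j <= size l)%N -> c j = 0%N) -> weave x c l = l.
Proof.
elim: l c => [|y l IHl] c c0 /=; first by rewrite c0.
by rewrite c0 //= IHl // => j jl; apply: c0.
Qed.

(** If [x] is not among the woven elements, the maximal runs of [x] can be read
off the result, hence so can their lengths and what separates them. *)
Lemma weave_inj x c c' l l' :
  x \notin l -> x \notin l' -> weave x c l = weave x c' l' ->
  l = l' /\ forall j, (j <= size l)%N -> c j = c' j.
Proof.
have E a a' r r' : x \notin take 1 r -> x \notin take 1 r' ->
    nseq a x ++ r = nseq a' x ++ r' -> a = a' /\ r = r'.
  elim: a a' => [|a IHa] [|a'] //= xr xr'.
  - by move=> h; move: xr; rewrite h /= inE eqxx.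
  - by move=> h; move: xr'; rewrite -h /= inE eqxx.
  - by case=> /(IHa _ xr xr')[-> ->].
elim: l l' c c' => [|y l IHl] [|y' l'] c c' /=.
- move=> _ _; rewrite -[nseq (c _) _]cats0 -[nseq (c' _) _]cats0.
  by case/E=> // c0 _; split=> // -[].
- rewrite inE negb_or -[nseq (c _) _]cats0 => _ /andP[xy' _].
  by case/E=> //=; rewrite take0 inE.
- rewrite inE negb_or -[nseq (c' _) _]cats0 => /andP[xy _] _.
  by case/E=> //=; rewrite take0 inE.
rewrite !inE !negb_or => /andP[xy xl] /andP[xy' xl'].
case/E=> /=; rewrite ?take0 ?inE // => c0 [-> /IHl[]// -> cS].
by split=> // -[//|j]; apply: cS.
Qed.

(** * Addresses, edges and heights *)

Fixpoint addrs (t : tree) : seq (seq nat) :=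
  let: Node ts := t in
  [::] :: flatten (mkseq (fun i => map (cons i) (nth [::] (map addrs ts) i))
                         (size ts)).

Lemma addrs_Node ts :
  addrs (Node ts) =
  [::] :: flatten (mkseq (fun i => map (cons i) (addrs (kid ts i))) (size ts)).
Proof.
rewrite /=; congr (_ :: flatten _); apply/eq_in_map => i.
by rewrite mem_iota /= => iS; rewrite (nth_map (Node [::])).
Qed.

Lemma subtree_Node ts i u :
  subtree (Node ts) (i :: u) =
  if i < size ts then subtree (kid ts i) u else None.
Proof.
rewrite /=; case: ltnP => iS; last by rewrite onth_default.
by rewrite onthE (nth_map (Node [::])).
Qed.

Lemma mem_addrs t u : (u \in addrs t) = isSome (subtree t u).
Proof.
elim/tree_ind_nth: t u => ts IH u; rewrite addrs_Node inE.
case: u => [//|i u]; rewrite subtree_Node /=.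
apply/flattenP/idP => [[s /mapP[i' + ->]]|].
  rewrite mem_iota add0n => /= i'S /mapP[u' u'P [-> ->]].
  by rewrite i'S -IH.
case: ltnP => // iS; rewrite -IH // => uP.
exists (map (cons i) (addrs (kid ts i))); last exact: map_f.
by apply/mapP; exists i; rewrite ?mem_iota.
Qed.

Lemma addrs_uniq t : uniq (addrs t).
Proof.
elim/tree_ind_nth: t => ts IH; rewrite addrs_Node /=; apply/andP; split.
  by apply/flattenP => -[s /mapP[i _ ->] /mapP[]].
have: forall n, n <= size ts ->
  uniq (flatten (mkseq (fun i => map (cons i) (addrs (kid ts i))) n)).
  elim=> [//|n IHn] nS; rewrite /mkseq -addn1 iotaD map_cat.
  rewrite flatten_cat /= cats0 cat_uniq IHn ?(ltnW nS) //= map_inj_uniq ?IH //.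
    rewrite andbT; apply/hasPn => u /mapP[u' _ ->]; apply/flattenP.
    move=> [s /mapP[i + ->] /mapP[v _ [ni _]]].
    by rewrite mem_iota -ni ltnn andbF.
  by move=> u v [].
exact.
Qed.

Lemma big_addrs (A : Type) (idx : A) (op : Monoid.law idx) ts
    (F : seq nat -> A) :
  \big[op/idx]_(u <- addrs (Node ts)) F u =
  op (F [::]) (\big[op/idx]_(i < size ts)
                  \big[op/idx]_(u <- addrs (kid ts i)) F (val i :: u)).
Proof.
rewrite addrs_Node big_cons; congr (op _ _).
rewrite big_flatten big_map -[X in iota 0 X](subn0 (size ts)) -/(index_iota _ _).
by rewrite big_mkord; apply: eq_bigr => i _; rewrite big_map.
Qed.

Definition arity (t : tree) (u : seq nat) : nat :=
  if subtree t u is Some v then size (children v) else 0.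

Lemma arity_Node ts i u : i < size ts ->
  arity (Node ts) (i :: u) = arity (kid ts i) u.
Proof. by move=> iS; rewrite /arity subtree_Node iS. Qed.

Fixpoint edges (t : tree) : nat :=
  let: Node ts := t in sumn [seq (edges t').+1 | t' <- ts].

Lemma edges_Node ts : edges (Node ts) = \sum_(t <- ts) (edges t).+1.
Proof. by rewrite /= sumnE big_map. Qed.

Lemma size_addrs t : size (addrs t) = (edges t).+1.
Proof.
elim/tree_ind_nth: t => ts IH.
rewrite -[LHS]sum1_size big_addrs /= add1n; congr _.+1.
rewrite -/(edges (Node ts)) edges_Node (big_nth (Node [::])) big_mkord.
by apply: eq_bigr => i _; rewrite sum1_size IH.
Qed.

Lemma sum_arity t : \sum_(u <- addrs t) arity t u = edges t.
Proof.
elim/tree_ind_nth: t => ts IH.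
rewrite big_addrs edges_Node (big_nth (Node [::])) big_mkord /=.
rewrite [X in X + _]/arity /= -[size ts in X in X + _]card_ord -sum1_card.
rewrite -big_split /=; apply: eq_bigr => i _.
rewrite add1n; congr _.+1; rewrite -IH //.
by apply: eq_bigr => u _; rewrite arity_Node.
Qed.

(** The arcs of [t] carry their addresses in the ambient tree, where [u0] is the
address of [t]. *)
Definition arcsum (c : slot -> nat) (u0 : seq nat) (t : tree) : nat :=
  \sum_(u <- addrs t) \sum_(j < (arity t u).+1) c (u0 ++ u, val j).

Lemma arcsum_Node c u0 ts :
  arcsum c u0 (Node ts) =
  \sum_(j < (size ts).+1) c (u0, val j) +
  \sum_(i < size ts) arcsum c (rcons u0 i) (kid ts i).
Proof.
rewrite /arcsum big_addrs /= cats0; congr (_ + _).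
apply: eq_bigr => i _; apply: eq_bigr => u _.
by rewrite arity_Node // cat_rcons.
Qed.

Lemma height_Node ts : height (Node ts) = (\max_(t <- ts) height t).+1.
Proof. by rewrite /= -(big_map height predT id) /= unlock; congr _.+1; elim: ts => //= t ts ->. Qed.

Lemma branchS k : branch k.+2 = Node [:: branch k.+1]. Proof. by []. Qed.

Lemma height_branch k : 0 < k -> height (branch k) = k.
Proof.
by case: k => // k _; elim: k => // k IH; rewrite branchS height_Node big_seq1 IH.
Qed.

Lemma edges_branch k : 0 < k -> (edges (branch k)).+1 = k.
Proof.
by case: k => // k _; elim: k => // k IH; rewrite branchS edges_Node big_seq1 IH.
Qed.

Lemma height_kid ts i : i < size ts -> height (kid ts i) < height (Node ts).
Proof.
move=> iS; rewrite height_Node ltnS (big_nth (Node [::])) big_mkord.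
exact: (leq_bigmax (Ordinal iS)).
Qed.

Lemma height_subtree t u v : subtree t u = Some v -> height v <= height t.
Proof.
elim: u t => [t [->]//|i u IH] [ts]; rewrite subtree_Node.
case: ltnP => // iS /IH; move/leq_trans; apply; exact/ltnW/height_kid.
Qed.

(** Each inserted [k]-branch brings [k] nodes. *)
Lemma edges_graft k c u0 t : 0 < k ->
  edges (graft k c u0 t) = edges t + k * arcsum c u0 t.
Proof.
move=> k0; elim/tree_ind_nth: t u0 => ts IH u0.
rewrite graft_Node !edges_Node big_weave size_mkseq edges_branch // arcsum_Node.
rewrite big_map -[X in iota 0 X](subn0 (size ts)) -/(index_iota _ _) big_mkord.
rewrite (big_nth (Node [::])) big_mkord big_const_ord iter_addn_0.
rewrite mulnDr addnCA; congr (_ + _).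
by rewrite big_distrr -big_split; apply: eq_bigr => i _; rewrite IH.
Qed.

(** A weak consequence of the slot rule, sufficient for heights and slot counts:
no branch is inserted at a node of height at most [k]. *)
Definition supported (k : nat) (c : slot -> nat) (u0 : seq nat) (t : tree) :=
  forall u v j, subtree t u = Some v -> c (u0 ++ u, j) != 0 -> k < height v.

Lemma supported_kid k c u0 ts i : i < size ts ->
  supported k c u0 (Node ts) -> supported k c (rcons u0 i) (kid ts i).
Proof.
move=> iS H u v j uv; rewrite cat_rcons; apply: H.
by rewrite subtree_Node iS.
Qed.

Lemma arcsum0 k c u0 t : supported k c u0 t -> height t <= k ->
  arcsum c u0 t = 0.
Proof.
move=> H tk; rewrite /arcsum big_seq big1 // => u; rewrite mem_addrs.
case E: (subtree t u) => [v|//] _; rewrite big1 // => j _.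
apply/eqP; apply: contraT => /(H _ _ _ E); rewrite ltnNge => /negP[].
exact: leq_trans (height_subtree E) tk.
Qed.

Lemma graft0 k c u0 t : supported k c u0 t -> height t <= k -> graft k c u0 t = t.
Proof.
elim/tree_ind_nth: t u0 => ts IH u0 H tk; rewrite graft_Node weave0.
  congr Node; apply: (@eq_from_nth _ (Node [::])); rewrite size_mkseq // => i iS.
  rewrite nth_mkseq // IH //; first exact: supported_kid.
  exact: leq_trans (ltnW (height_kid iS)) tk.
move=> j _; apply/eqP; apply: contraT => cj.
have := H [::] (Node ts) j erefl; rewrite cats0 => /(_ cj).
by rewrite ltnNge tk.
Qed.

(** A node that receives [k]-branches already has a child of height at least
[k], by the support condition. *)
Lemma height_graft k c u0 t : 0 < k -> supported k c u0 t ->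
  height (graft k c u0 t) = height t.
Proof.
move=> k0; elim/tree_ind_nth: t u0 => ts IH u0 H.
rewrite graft_Node !height_Node big_weave size_mkseq height_branch //; congr _.+1.
rewrite big_map -[X in iota 0 X](subn0 (size ts)) -/(index_iota _ _) big_mkord.
rewrite (big_nth (Node [::])) big_mkord.
rewrite /= (eq_bigr (fun i : 'I_(size ts) => height (kid ts i))); last first.
  by move=> i _; rewrite IH //; exact: supported_kid.
case: (posnP (\sum_(j < (size ts).+1) c (u0, val j))) => [->|].
  by rewrite big_ord0 max0n.
rewrite lt0n sum_nat_eq0 negb_forall => /existsP[j /= cj].
apply/maxn_idPr; apply/bigmax_leqP => _ _.
have := H [::] (Node ts) j erefl; rewrite cats0 => /(_ cj).
by rewrite height_Node ltnS (big_nth (Node [::])) big_mkord.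
Qed.

(** * Counting slots *)

(** The slot rule at a node other than the root, which depends only on the
subtree at that node. *)
Definition inner_slot (k : nat) (v : tree) (j : nat) : bool :=
  (j <= size (children v)) &&
  ((k.+1 < height v) ||
   (height v == k.+1) &&
   all (fun i => leaf_path k (kid (children v) i) ==> (j <= i))
       (iota 0 (size (children v)))).

Lemma inner_slot_height k v j : inner_slot k v j -> k < height v.
Proof. by case/andP=> _ /orP[/ltnW//|/andP[/eqP->]]. Qed.

Lemma is_kslot_inner k t u v j : u != [::] -> subtree t u = Some v ->
  is_kslot k t (u, j) = inner_slot k v j.
Proof. by rewrite /is_kslot /inner_slot => /negPf-> ->. Qed.

Lemma is_kslot_root k t j : is_kslot k t ([::], j) = (j <= size (children t)).
Proof. by rewrite /= andbT. Qed.

Definition own_slots (k : nat) (v : tree) : nat :=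
  \sum_(j < (size (children v)).+1) inner_slot k v j.

Fixpoint inner_slots (k : nat) (t : tree) : nat :=
  let: Node ts := t in own_slots k t + sumn (map (inner_slots k) ts).

Definition nslots (k : nat) (t : tree) : nat :=
  (size (children t)).+1 + \sum_(v <- children t) inner_slots k v.

Lemma inner_slots_Node k ts :
  inner_slots k (Node ts) =
  own_slots k (Node ts) + \sum_(t <- ts) inner_slots k t.
Proof. by rewrite /= sumnE big_map. Qed.

Lemma own_slots_full k v : k.+1 < height v ->
  own_slots k v = (size (children v)).+1.
Proof.
move=> kv; rewrite /own_slots -[RHS]card_ord -sum1_card; apply: eq_bigr => j _.
by rewrite /inner_slot kv -ltnS ltn_ord.
Qed.

Lemma arcsum_inner_slot k c u0 t :
  (forall u v j, subtree t u = Some v -> c (u0 ++ u, j) = inner_slot k v j) ->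
  arcsum c u0 t = inner_slots k t.
Proof.
elim/tree_ind_nth: t u0 => ts IH u0 H; rewrite arcsum_Node inner_slots_Node.
congr (_ + _).
  by apply: eq_bigr => j _; rewrite -(H [::]) ?cats0.
rewrite (big_nth (Node [::])) big_mkord; apply: eq_bigr => i _; apply: IH => //.
by move=> u v j uv; rewrite cat_rcons; apply: H; rewrite subtree_Node ltn_ord.
Qed.

Lemma arcsum_kslot k t : arcsum (fun s => is_kslot k t s) [::] t = nslots k t.
Proof.
case: t => ts; rewrite arcsum_Node /nslots; congr (_ + _).
  rewrite -[RHS]card_ord -sum1_card; apply: eq_bigr => j _.
  by rewrite is_kslot_root /= -ltnS ltn_ord.
rewrite (big_nth (Node [::])) big_mkord; apply: eq_bigr => i _.
apply: arcsum_inner_slot => u v j uv; rewrite (@is_kslot_inner _ _ _ v) //=.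
by rewrite onthE (nth_map (Node [::])).
Qed.

Lemma leaf_path_branch k : 0 < k -> leaf_path k (branch k).
Proof. by case: k => // k _; elim: k => // k IH; rewrite branchS /= orbF. Qed.

(** In a branch of length [k + 1], the top node has height [k + 1] and its only
child starts a path of [k] nodes; the only slot is the one to its left. *)
Lemma inner_slot_branch k j : 0 < k -> inner_slot k (branch k.+1) j = (j == 0).
Proof.
case: k => // k _.
have -> : inner_slot k.+1 (branch k.+2) j = (j <= 1) &&
  ((k.+2 < height (branch k.+2)) || (height (branch k.+2) == k.+2) &&
   ((leaf_path k.+1 (branch k.+1) ==> (j <= 0)) && true)) by [].
by rewrite height_branch // ltnn eqxx leaf_path_branch //; case: j => [|[]].
Qed.

(** A node of a [k]-branch has two [l]-slots if its height exceeds [l + 1], one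
if it equals [l + 1] and none below, which gives [2 * (k - l) - 1] when [l < k]. *)
Lemma inner_slots_branch k l : 0 < l -> 0 < k ->
  inner_slots l (branch k) = (2 * (k - l)).-1.
Proof.
move=> l0; case: k => // k _; elim: k => [|k IH].
  rewrite /= addn0 /own_slots big1 => [|j _]; first lia.
  apply/eqP; rewrite eqb0; apply/negP => /inner_slot_height /=; lia.
rewrite branchS inner_slots_Node big_seq1 IH -branchS.
have [kl|kl|<-] := ltngtP k.+1 l.
- rewrite /own_slots big1 => [|j _]; first lia.
  apply/eqP; rewrite eqb0; apply/negP => /inner_slot_height.
  by rewrite height_branch //; lia.
- rewrite own_slots_full ?height_branch // branchS [size _]/=; lia.
have -> : own_slots k.+1 (branch k.+2) = \sum_(j < 2) (val j == 0).
  by apply: eq_bigr => j _; rewrite inner_slot_branch.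
by rewrite !big_ord_recl big_ord0 /=; lia.
Qed.

(** For [l < k], an inserted [k]-branch creates [2 * (k - l) - 1] slots on its
own nodes and one more by splitting the arc in which it lands. This arc belongs
to a node of height above [k], hence at least [l + 2], all arcs of which are
[l]-slots. *)
Lemma inner_slots_graft k l c u0 t : 0 < l < k -> supported k c u0 t ->
  inner_slots l (graft k c u0 t) = inner_slots l t + 2 * (k - l) * arcsum c u0 t.
Proof.
move=> /andP[l0 lk]; elim/tree_ind_nth: t u0 => ts IH u0 H.
have [tk|tk] := leqP (height (Node ts)) k.
  by rewrite (graft0 H) // (arcsum0 H) // muln0 addn0.
have hg : l.+1 < height (graft k c u0 (Node ts)).
  by rewrite height_graft //; lia.
move: hg; rewrite graft_Node => hg.
rewrite !inner_slots_Node !own_slots_full //; last by lia.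
rewrite [children _]/= [children (Node ts)]/= size_weave big_weave size_mkseq.
rewrite inner_slots_branch //; last by lia.
rewrite sum_nat_const card_ord.
rewrite big_map -[X in iota 0 X](subn0 (size ts)) -/(index_iota _ _) big_mkord.
rewrite (big_nth (Node [::])) big_mkord arcsum_Node mulnDr /=.
rewrite (eq_bigr (fun i : 'I_(size ts) => inner_slots l (kid ts i) +
  2 * (k - l) * arcsum c (rcons u0 i) (kid ts i))); last first.
  by move=> i _; rewrite IH //; exact: supported_kid.
rewrite big_split /= -big_distrr /=; have : 0 < 2 * (k - l) by lia.
case: (2 * (k - l)) => // m _; rewrite [m.+1.-1]/= mulSn (mulnC m). lia.
Qed.

(** The numbers [c] vanish outside the [k]-slots, for the rule at nodes other
than the root. *)
Definition slotted (k : nat) (c : slot -> nat) (u0 : seq nat) (t : tree) :=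
  forall u v j, subtree t u = Some v -> c (u0 ++ u, j) != 0 -> inner_slot k v j.

Lemma slotted_supported k c u0 t : slotted k c u0 t -> supported k c u0 t.
Proof. by move=> H u v j uv /(H _ _ _ uv)/inner_slot_height. Qed.

Lemma slotted_kid k c u0 ts i : i < size ts ->
  slotted k c u0 (Node ts) -> slotted k c (rcons u0 i) (kid ts i).
Proof.
move=> iS H u v j uv; rewrite cat_rcons; apply: H.
by rewrite subtree_Node iS.
Qed.

Lemma slotted_attach k n ts i : i < size ts ->
  slotted k (fun s => if is_kslot k (Node ts) s then n s else 0)
    [:: i] (kid ts i).
Proof.
move=> iS u v j uv; rewrite (@is_kslot_inner _ _ (i :: u) v) //.
  by case: ifP.
by rewrite subtree_Node iS.
Qed.

Definition nattached (k : nat) (n : slot -> nat) (t : tree) : nat :=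
  arcsum (fun s => if is_kslot k t s then n s else 0) [::] t.

Lemma edges_attach k n t : 0 < k ->
  edges (attach k n t) = edges t + k * nattached k n t.
Proof. exact: edges_graft. Qed.

(** Same count as for a proper subtree; the root differs only in that all its
arcs are slots whatever its height. *)
Lemma nslots_attach k l n t : 0 < l < k ->
  nslots l (attach k n t) = nslots l t + 2 * (k - l) * nattached k n t.
Proof.
case: t => ts lk; rewrite /attach -/(graft _ _ _ _) /nattached.
have := @slotted_attach k n ts; set c := fun s => if _ then _ else _ => H.
rewrite graft_Node /nslots /= size_weave big_weave size_mkseq.
rewrite inner_slots_branch //; [|by lia..].
rewrite sum_nat_const card_ord.
rewrite big_map -[X in iota 0 X](subn0 (size ts)) -/(index_iota _ _) big_mkord.
rewrite (big_nth (Node [::])) big_mkord arcsum_Node mulnDr /=.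
rewrite (eq_bigr (fun i : 'I_(size ts) => inner_slots l (kid ts i) +
  2 * (k - l) * arcsum c [:: val i] (kid ts i))); last first.
  by move=> i _; rewrite (inner_slots_graft lk) //; exact/slotted_supported/H.
rewrite big_split /= -big_distrr /=; have : 0 < 2 * (k - l) by lia.
case: (2 * (k - l)) => // m _; rewrite [m.+1.-1]/= mulSn (mulnC m). lia.
Qed.

Lemma height_attach k n t : 0 < k -> k < height t ->
  height (attach k n t) = height t.
Proof.
move=> k0 kt; apply: height_graft => // -[|i u] v j; first by case=> <-.
case: t {kt} => ts; rewrite subtree_Node; case: ltnP => // iS.
exact: (slotted_supported (@slotted_attach k n ts i iS)).
Qed.

Definition kslots (k : nat) (t : tree) : seq slot :=
  [seq s <- [seq (u, j) | u <- addrs t, j <- iota 0 (arity t u).+1]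
  | is_kslot k t s].

Lemma mem_kslots k t s : (s \in kslots k t) = is_kslot k t s.
Proof.
rewrite mem_filter; case E: is_kslot => [|//]; rewrite andTb; case: s E => u j E.
apply/allpairsPdep; exists u, j; split=> //.
  by rewrite mem_addrs; move: E; rewrite /is_kslot; case: subtree.
move: E; rewrite /is_kslot /arity mem_iota.
by case: subtree => // v /andP[].
Qed.

Lemma kslots_uniq k t : uniq (kslots k t).
Proof.
apply: filter_uniq; apply: allpairs_uniq_dep => //.
- exact: addrs_uniq.
- by move=> u _; exact: iota_uniq.
- by move=> [u j] [u' j'] _ _ /= [-> ->].
Qed.

Lemma sum_kslots k t f :
  \sum_(s <- kslots k t) f s =
  arcsum (fun s => if is_kslot k t s then f s else 0) [::] t.
Proof.
rewrite big_filter big_mkcond big_allpairs_dep /arcsum; apply: eq_bigr => u _.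
by rewrite -[X in iota 0 X](subn0 _) -/(index_iota _ _) big_mkord.
Qed.

Lemma size_kslots k t : size (kslots k t) = nslots k t.
Proof.
by rewrite -sum1_size sum_kslots -arcsum_kslot; congr arcsum.
Qed.

(** * Injectivity of the attaching procedure *)

(** Shape of the subtrees at non-root nodes in a tree made of branches of size
at least [k]: as [l]-branches are attached to nodes of height above [l], the
nodes of height at most [k] still belong to the unbranched ends of branches. *)
Inductive pruned (k : nat) : tree -> Prop :=
| pruned_branch : pruned k (branch k)
| pruned_node ts : ts != [::] -> (forall t, t \in ts -> pruned k t) ->
    pruned k (Node ts).

Lemma pruned_height k t : 0 < k -> pruned k t ->
  k <= height t /\ (height t = k -> t = branch k).
Proof.
move=> k0; elim=> [|ts ts0 _ IH]; first by rewrite height_branch.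
suff: k < height (Node ts) by split; lia.
case: ts ts0 IH => // v ts _ IH; rewrite height_Node ltnS big_cons leq_max.
by case: (IH v (mem_head _ _)) => ->.
Qed.

(** At a node of height [k + 1] the new branches are copies of its only child,
all put on the left of it: only their number can be seen afterwards. This is the
reason for the rule on the nodes of height [k + 1]. *)
Lemma graft_branch k c u0 : 0 < k -> slotted k c u0 (branch k.+1) ->
  graft k c u0 (branch k.+1) = Node (nseq (c (u0, 0)).+1 (branch k)).
Proof.
case: k => // k _ H; rewrite branchS in H *; rewrite graft_Node /mkseq /=.
have := slotted_kid (isT : 0 < size [:: branch k.+1]) H => /slotted_supported/graft0.
rewrite [height _]height_branch // => /(_ (leqnn _)) /= ->.
have -> : c (u0, 1) = 0.
  apply/eqP; apply: contraT => c1.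
  have := H [::] (Node [:: branch k.+1]) 1 erefl.
  by rewrite cats0 -branchS => /(_ c1); rewrite inner_slot_branch.
by congr Node; elim: (c _) => //= n ->.
Qed.

Lemma pruned_graft k c u0 t : 0 < k -> slotted k c u0 t -> pruned k.+1 t ->
  pruned k (graft k c u0 t).
Proof.
move=> k0 + tP; elim: tP u0 => [|ts ts0 _ IH] u0 H.
  rewrite graft_branch //; apply: pruned_node => // v.
  by rewrite mem_nseq => /eqP->; exact: pruned_branch.
rewrite graft_Node; apply: pruned_node.
  by move: ts0; rewrite -!size_eq0 size_weave size_mkseq addn_eq0 negb_and orbC => ->.
move=> v /mem_weave[->|]; first exact: pruned_branch.
case/mapP => i; rewrite mem_iota /= => iS ->.
by apply: IH; [exact: mem_nth | exact: slotted_kid].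
Qed.

(** The old children have height at least [k + 1], before and after grafting,
so they are told apart from the inserted [k]-branches. *)
Lemma weave_graft_inj k c c' u0 ts ts' : 0 < k ->
  (forall t, t \in ts -> pruned k.+1 t) ->
  (forall t, t \in ts' -> pruned k.+1 t) ->
  (forall i, i < size ts -> slotted k c (rcons u0 i) (kid ts i)) ->
  (forall i, i < size ts' -> slotted k c' (rcons u0 i) (kid ts' i)) ->
  graft k c u0 (Node ts) = graft k c' u0 (Node ts') ->
  [/\ size ts = size ts',
      forall i, i < size ts ->
        graft k c (rcons u0 i) (kid ts i) = graft k c' (rcons u0 i) (kid ts' i)
    & forall j, j <= size ts -> c (u0, j) = c' (u0, j)].
Proof.
move=> k0 tsP ts'P H H'.
have notin a l : (forall t, t \in l -> pruned k.+1 t) ->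
    (forall i, i < size l -> slotted k a (rcons u0 i) (kid l i)) ->
    branch k \notin mkseq (fun i => graft k a (rcons u0 i) (kid l i)) (size l).
  move=> lP al; apply/mapP => -[i]; rewrite mem_iota /= => iS.
  move/(congr1 height); rewrite height_branch // height_graft //.
    have [] := pruned_height (ltn0Sn k) (lP _ (mem_nth (Node [::]) iS)).
    by move=> + _ kE; rewrite -kE ltnn.
  exact/slotted_supported/al.
rewrite !graft_Node => -[]; case/weave_inj; [exact: notin..|] => E cE.
have sE : size ts = size ts' by move/(congr1 size): E; rewrite !size_mkseq.
split=> // [i iS|j jS]; last by apply: cE; rewrite size_mkseq.
move/(congr1 (fun l => kid l i)): E; rewrite !nth_mkseq //.
by rewrite -sE.
Qed.

(** As grafting preserves heights, the height of the result tells whether the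
subtree was a branch of length [k + 1] or a node whose children all have height
at least [k + 1]. In the first case the number of children gives the number of
inserted branches; in the second one [weave_graft_inj] applies. *)
Lemma graft_inj k c c' u0 t t' : 0 < k -> pruned k.+1 t -> pruned k.+1 t' ->
  slotted k c u0 t -> slotted k c' u0 t' -> graft k c u0 t = graft k c' u0 t' ->
  t = t' /\ forall u j, u \in addrs t -> j <= arity t u ->
    c (u0 ++ u, j) = c' (u0 ++ u, j).
Proof.
move=> k0 tp; elim: tp t' u0 => [|ts ts0 tsP IH] t' u0 t'P H H' E.
  have tE : t' = branch k.+1.
    have [_ ->//] := pruned_height (ltn0Sn k) t'P.
    rewrite -(height_graft k0 (slotted_supported H')) -E height_graft //.
      by rewrite height_branch.
    exact: slotted_supported.
  rewrite tE in H' E *; split=> // u j.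
  rewrite !graft_branch // in E.
  case: E => /(congr1 size); rewrite /= !size_nseq => cE; rewrite mem_addrs.
  case uE: subtree => [v|//] _ _.
  have eq0 a : slotted k a u0 (branch k.+1) -> ~~ inner_slot k v j ->
      a (u0 ++ u, j) = 0.
    by move=> aH; apply: contraNeq; exact: aH.
  case vj: (inner_slot k v j); last by rewrite !eq0 ?vj.
  case: u uE eq0 => [|i u].
    case=> vE; move: vj; rewrite -vE inner_slot_branch // => /eqP->.
    by rewrite cats0.
  have kE : branch k.+1 = Node [:: branch k] by case: (k) k0.
  rewrite kE subtree_Node; case: ltnP => // iS /height_subtree vk _.
  move/inner_slot_height: vj; move: iS vk; case: i => // _.
  by rewrite [kid _ _]/= height_branch //; lia.
case: t' / t'P E H' => [|ts' ts'0 ts'P] E H'.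
  (* grafting keeps the height k + 1 of a branch; a node of the other kind
     is higher *)
  have kE : branch k.+1 = Node [:: branch k] by case: (k) k0.
  have := height_graft k0 (slotted_supported H).
  rewrite E height_graft ?height_branch //; last exact: slotted_supported.
  case: ts ts0 tsP {IH E H} => // v ts _ tsP; rewrite height_Node big_cons.
  have [+ _] := pruned_height (ltn0Sn k) (tsP v (mem_head _ _)).
  by move=> kt [] kE'; move: kt; rewrite {1}kE' gtn_max ltnn.
have [||sE gE cE] := weave_graft_inj k0 tsP ts'P _ _ E.
- by move=> i iS; exact: slotted_kid.
- by move=> i iS; exact: slotted_kid.
have kidE i : i < size ts -> kid ts i = kid ts' i /\
    forall u j, u \in addrs (kid ts i) -> j <= arity (kid ts i) u ->
      c (rcons u0 i ++ u, j) = c' (rcons u0 i ++ u, j).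
  move=> iS; have iS' : i < size ts' by rewrite -sE.
  apply: IH.
  - exact: mem_nth.
  - exact/ts'P/mem_nth.
  - exact: slotted_kid.
  - exact: slotted_kid.
  - exact: gE.
split.
  by congr Node; apply: (@eq_from_nth _ (Node [::]) _ _ sE) => i /kidE[].
case=> [|i u] j; first by rewrite cats0 => _; exact: cE.
rewrite mem_addrs subtree_Node; case: ltnP => // iS; rewrite -mem_addrs => ui.
by rewrite arity_Node // -cat_rcons => ji; case: (kidE i iS) => _; exact.
Qed.

(** All arcs of the root are slots, so the root itself is never the top of an
unbranched end. *)
Definition root_pruned (k : nat) (t : tree) :=
  forall v, v \in children t -> pruned k v.

Lemma root_pruned_attach k n t : 0 < k -> root_pruned k.+1 t ->
  root_pruned k (attach k n t).
Proof.
case: t => ts k0 tP v; rewrite /attach -/(graft _ _ _ _) graft_Node /=.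
case/mem_weave => [->|]; first exact: pruned_branch.
case/mapP => i; rewrite mem_iota /= => iS ->.
by apply: pruned_graft => //; [exact: slotted_attach | exact/tP/mem_nth].
Qed.

Lemma attach_inj k n n' t t' : 0 < k ->
  root_pruned k.+1 t -> root_pruned k.+1 t' ->
  attach k n t = attach k n' t' ->
  t = t' /\ forall s, is_kslot k t s -> n s = n' s.
Proof.
case: t => ts; case: t' => ts' k0 tP t'P E.
have [||sE gE cE] := weave_graft_inj k0 tP t'P _ _ E.
- by move=> i iS; exact: slotted_attach.
- by move=> i iS; exact: slotted_attach.
have kidE i (iS : i < size ts) := graft_inj k0 (tP _ (mem_nth _ iS))
  (t'P (kid ts' i) (mem_nth _ (etrans (congr1 _ (esym sE)) iS)))
  (slotted_attach iS) (slotted_attach (etrans (congr1 _ (esym sE)) iS)) (gE i iS).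
have tE : ts = ts' by apply: (@eq_from_nth _ (Node [::]) _ _ sE) => i /kidE[].
split=> [|[u j] sk]; first by rewrite tE.
have ck : (if is_kslot k (Node ts) (u, j) then n (u, j) else 0) =
          (if is_kslot k (Node ts') (u, j) then n' (u, j) else 0).
  move: sk; rewrite {1}/is_kslot; case E1: subtree => [v|//] /andP[jv _].
  case: u E1 jv => [[<-]|i u uE jv]; first exact: cE.
  move: uE; rewrite subtree_Node; case: ltnP => // iS uE.
  have [_ /(_ u j)] := kidE i iS; rewrite mem_addrs uE /arity uE; exact.
by move: ck; rewrite -tE sk.
Qed.

Lemma eq_attach k n n' t : (forall s, is_kslot k t s -> n s = n' s) ->
  attach k n t = attach k n' t.
Proof.
move=> H; rewrite /attach; congr insert_at; apply/funext => s.
by case: ifP => // /H->.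
Qed.

Local Open Scope classical_set_scope.
Local Open Scope ring_scope.

(** * The sequence q *)

Definition pprod (R : realType) (q : nat -> R) (n : nat) : R :=
  \prod_(1 <= j < n.+1) q j.

(** By [nslots_attach], the factor that a [k]-branch contributes through the
slots it creates for the smaller branches. *)
Definition slot_prod (R : realType) (q : nat -> R) (k : nat) : R :=
  \prod_(1 <= j < k) q j ^+ (2 * (k - j)).

Lemma pprodS (R : realType) (q : nat -> R) n :
  pprod q n.+1 = pprod q n * q n.+1.
Proof. by rewrite /pprod big_nat_recr. Qed.

Lemma pprod0 (R : realType) (q : nat -> R) : pprod q 0 = 1.
Proof. by rewrite /pprod big_geq. Qed.

Lemma slot_prodS (R : realType) (q : nat -> R) k :
  slot_prod q k.+2 = slot_prod q k.+1 * pprod q k.+1 ^+ 2.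
Proof.
rewrite pprodS exprMn mulrA /slot_prod [in LHS]big_nat_recr //=.
congr (_ * _); last by rewrite subSnn.
rewrite /pprod -prodrXl -big_split /=; apply: eq_big_nat => i /andP[_ ik].
by rewrite -exprD; congr (_ ^+ _); lia.
Qed.

Section Recursion.
Variables (R : realType) (lambda : R) (q : nat -> R).
Hypothesis lambda_gt0 : 0 < lambda.
Hypothesis lambda_le : lambda <= 1 / 2.
Let x := lambda * (1 - lambda).
Hypothesis qE : forall k, (0 < k)%N -> q k = 1 - x ^+ k / slot_prod q k.

(** The reciprocals [G n] of [pprod q n] satisfy [G 0 = 1] and
[G n.+1 = 1 / (1 - x * G n)]: [G n] is the generating function, evaluated at
[x], of the number of edges of planar trees with at most [n] generations of
descendants. The bound holds since [1 - lambda] is a fixed point of the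
increasing map [p |-> 1 - x / p]. *)
Lemma pprod_rec n : [/\ pprod q n.+1 = 1 - x / pprod q n,
  1 - lambda < pprod q n, 0 < q n.+1 & 0 < slot_prod q n.+1].
Proof.
have := lambda_le; have := lambda_gt0 => l0 le; have l1 : 0 < 1 - lambda by lra.
have x0 : 0 < x by rewrite mulr_gt0.
have step (a : R) : 1 - lambda < a -> 1 - lambda < 1 - x / a.
  move=> la; have a0 : 0 < a by lra.
  have : x / a < lambda by rewrite ltr_pdivrMr // /x; nra.
  lra.
elim: n => [|n [pS pn qn sn]].
  have s1 : slot_prod q 1 = 1 by rewrite /slot_prod big_geq.
  have p1 : pprod q 1 = 1 - x / pprod q 0.
    by rewrite pprodS pprod0 mul1r qE // s1 expr1.
  rewrite p1 s1 pprod0 divr1 ltr01 qE // s1 expr1 divr1; split=> //; first lra.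
  by rewrite /x; nra.
have pSn : 1 - lambda < pprod q n.+1 by rewrite pS; exact: step.
have pn0 : 0 < pprod q n by lra.
have pSn0 : 0 < pprod q n.+1 by lra.
have sS : 0 < slot_prod q n.+2 by rewrite slot_prodS mulr_gt0 // exprn_gt0.
have pSS : pprod q n.+2 = 1 - x / pprod q n.+1.
  have qS1 : x ^+ n.+1 / slot_prod q n.+1 = 1 - q n.+1 by rewrite (qE (ltn0Sn n)); ring.
  rewrite pprodS qE // slot_prodS exprS.
  have -> : x * x ^+ n.+1 / (slot_prod q n.+1 * pprod q n.+1 ^+ 2) =
     (x ^+ n.+1 / slot_prod q n.+1) * x / pprod q n.+1 ^+ 2.
    by field; rewrite !gt_eqF.
  rewrite qS1; have qn1 : q n.+1 = pprod q n.+1 / pprod q n.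
    by rewrite pprodS; field; rewrite gt_eqF.
  rewrite qn1; move: pS.
  set a := pprod q n in pn0 *; set b := pprod q n.+1 in pSn0 *.
  have a0 : a != 0 by rewrite gt_eqF.
  have b0 : b != 0 by rewrite gt_eqF.
  move=> bE; have xE : x = (1 - b) * a by rewrite bE; field.
  by rewrite xE; field; rewrite a0 b0.
split=> //.
have : 0 < pprod q n.+2 by rewrite pSS; have := step _ pSn; lra.
by rewrite pprodS pmulr_rgt0.
Qed.

Lemma pprod_gt n : 1 - lambda < pprod q n.
Proof. by case: (pprod_rec n). Qed.

Lemma pprod_gt0 n : 0 < pprod q n.
Proof. by have := pprod_gt n; have := lambda_le; have := lambda_gt0; lra. Qed.

Lemma q_gt0 k : (0 < k)%N -> 0 < q k.
Proof. by case: k => // k _; case: (pprod_rec k). Qed.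

Lemma slot_prod_gt0 k : (0 < k)%N -> 0 < slot_prod q k.
Proof. by case: k => // k _; case: (pprod_rec k). Qed.

Lemma q_lt1 k : (0 < k)%N -> q k < 1.
Proof.
move=> k0; rewrite (qE k0) ltrBlDr ltrDl divr_gt0 ?slot_prod_gt0 //.
by rewrite exprn_gt0 // mulr_gt0 //; have := lambda_le; lra.
Qed.

(** The limit is a root of [L = 1 - x / L], that is, [lambda] or [1 - lambda];
as it is at least [1 - lambda >= lambda], it is [1 - lambda]. *)
Lemma cvg_pprod : pprod q n @[n --> \oo] --> 1 - lambda.
Proof.
have := lambda_le; have := lambda_gt0 => l0 le.
have dec : nonincreasing_seq (pprod q).
  apply/nonincreasing_seqP => n; rewrite pprodS ler_piMr ?ltW ?pprod_gt0 //.
  exact: q_lt1.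
have lb : has_lbound (range (pprod q)).
  by exists (1 - lambda) => _ [n _ <-]; exact/ltW/pprod_gt.
have cv := nonincreasing_is_cvgn dec lb.
set L := limn (pprod q) in cv.
have cvL : pprod q n @[n --> \oo] --> L by exact: cv.
have L1 : 1 - lambda <= L.
  by apply: limr_ge => //; near=> n; exact/ltW/pprod_gt.
have L0 : L != 0 by rewrite gt_eqF //; lra.
have cS : pprod q n.+1 @[n --> \oo] --> 1 - x / L.
  under eq_fun => n do case: (pprod_rec n) => -> _ _ _.
  apply: cvgB; first exact: cvg_cst.
  by apply: cvgM; [exact: cvg_cst|exact: cvgV].
have cS' : pprod q n.+1 @[n --> \oo] --> L by rewrite -cvg_shiftS in cvL.
have LE : L = 1 - x / L by exact: cvg_unique cS' cS.
have : (L - lambda) * (L - (1 - lambda)) = 0.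
  have : L * L = L - x by rewrite {1}LE mulrBl mul1r divfK.
  by rewrite /x; nra.
move/eqP; rewrite mulf_eq0 => /orP[] /eqP h.
  by have <- : L = 1 - lambda by lra.
by have <- : L = 1 - lambda by lra.
Unshelve. all: by end_near.
Qed.

Lemma max_gen_lawE m : max_gen_law q m = (1 - q m) * ((1 - lambda) / pprod q m).
Proof.
rewrite /max_gen_law; congr (_ * _); apply/cvg_lim => //.
rewrite -(@cvg_shiftn m.+1).
have -> : (fun n => \prod_(m.+1 <= l < n + m.+1) q l) =
          (fun n => pprod q (n + m) / pprod q m).
  apply/funext => n; rewrite /pprod -addnS (@big_cat_nat _ _ _ m.+1 1 (n + m.+1)) //=.
    by rewrite mulrC mulKf // gt_eqF // pprod_gt0.
  by rewrite leq_addl.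
apply: cvgM; last exact: cvg_cst.
by rewrite (@cvg_shiftn m _ (pprod q)); exact: cvg_pprod.
Qed.

Lemma max_gen_law_ge0 m : q 0%N = 0 -> 0 <= max_gen_law q m.
Proof.
move=> q0; rewrite max_gen_lawE mulr_ge0 ?divr_ge0 ?ltW ?pprod_gt0 //; last by have := lambda_le; lra.
by case: m => [|m]; rewrite ?q0 subr_gt0 // q_lt1.
Qed.

(** The sum telescopes: its partial sums are [(1 - lambda) / pprod q n]. *)
Lemma sum_max_gen_law : q 0%N = 0 ->
  (\sum_(0 <= m <oo) (max_gen_law q m)%:E = 1)%E.
Proof.
move=> q0; apply/cvg_lim => //.
have S n : (\sum_(0 <= m < n.+1) (max_gen_law q m)%:E)%E =
    ((1 - lambda) / pprod q n)%:E.
  rewrite sumEFin; congr EFin; elim: n => [|n IH].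
    by rewrite big_nat1 max_gen_lawE q0 pprod0; ring.
  rewrite big_nat_recr //= IH max_gen_lawE pprodS.
  by field; rewrite !gt_eqF // ?q_gt0 // pprod_gt0.
rewrite -cvg_shiftS /=; under eq_fun => n do rewrite S.
apply: cvg_EFin; first by near=> n.
have l1 : 1 - lambda != 0 by rewrite gt_eqF //; have := lambda_le; lra.
rewrite -[X in _ --> X](divff l1).
by apply: cvgM; [exact: cvg_cst | apply: cvgV => //; exact: cvg_pprod].
Unshelve. all: by end_near.
Qed.

End Recursion.

(** * The mass of a tree at each stage of the construction *)

(** For [k = 1] this is the mass of [t] under the branching process. For larger
[k], attaching no branch of size below [k] to [t] has probability
[\prod_(1 <= j < k) q j ^+ nslots j t] and yields [t] in the end. *)
Definition tree_weight (R : realType) (lambda : R) (q : nat -> R) (k : nat)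
    (t : tree) : R :=
  (1 - lambda) * (lambda * (1 - lambda)) ^+ edges t /
  \prod_(1 <= j < k) q j ^+ nslots j t.

Section Weights.
Variables (R : realType) (lambda : R) (q : nat -> R).
Hypothesis lambda_gt0 : 0 < lambda.
Hypothesis lambda_le : lambda <= 1 / 2.
Let x := lambda * (1 - lambda).
Hypothesis qE : forall k, (0 < k)%N -> q k = 1 - x ^+ k / slot_prod q k.
Local Notation W := (tree_weight lambda q).

Let q_pos k : (0 < k)%N -> 0 < q k.
Proof. exact: q_gt0 lambda_gt0 lambda_le qE k. Qed.

Lemma tree_weight_ge0 k t : 0 <= W k t.
Proof.
have := lambda_le; have := lambda_gt0 => l0 le.
rewrite /tree_weight divr_ge0 //.
  by rewrite mulr_ge0 ?exprn_ge0 ?mulr_ge0 //; lra.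
rewrite big_nat; apply: prodr_ge0 => j /andP[j0 _].
by rewrite exprn_ge0 // ltW // q_pos.
Qed.

(** Each attached branch costs [1 - q k = x ^+ k / slot_prod q k]; the numerator
pays for its [k] edges and the denominator for the slots that it creates. *)
Lemma tree_weight_attach k n t : (0 < k)%N ->
  W k (attach k n t) =
  W k.+1 t * (q k ^+ nslots k t * (1 - q k) ^+ nattached k n t).
Proof.
move=> k0; set S := nattached k n t.
have s0 : slot_prod q k != 0.
  by rewrite gt_eqF // (slot_prod_gt0 lambda_gt0 lambda_le qE).
have -> : 1 - q k = x ^+ k / slot_prod q k by rewrite qE //; ring.
rewrite /tree_weight edges_attach // exprD exprM -/x -/S big_nat_recr //=.
have -> : \prod_(1 <= j < k) q j ^+ nslots j (attach k n t) =
    \prod_(1 <= j < k) q j ^+ nslots j t * slot_prod q k ^+ S.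
  rewrite /slot_prod -prodrXl -big_split /=; apply: eq_big_nat => j jk.
  by rewrite nslots_attach // exprD exprM.
have d0 : \prod_(1 <= j < k) q j ^+ nslots j t != 0.
  rewrite prodf_seq_neq0; apply/allP => j; rewrite mem_index_iota => /andP[j0 _].
  by rewrite expf_neq0 // gt_eqF // q_pos.
have qn : q k ^+ nslots k t != 0 by rewrite expf_neq0 // gt_eqF // q_pos.
rewrite expr_div_n; field.
by rewrite d0 qn expf_neq0.
Qed.

Lemma prod_geom_kslots k n t :
  \prod_(s <- kslots k t) geom (q k) (n s) =
  q k ^+ nslots k t * (1 - q k) ^+ nattached k n t.
Proof.
rewrite /geom big_split /= /nattached -sum_kslots; congr (_ * _).
  by rewrite big_const_seq count_predT size_kslots iter_mulr_1.
by elim/big_rec2: _ => [|s y1 y2 _ ->]; rewrite ?expr0 // exprD.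
Qed.

Lemma tree_weight_root m : W m.+1 (Node [::]) = (1 - lambda) / pprod q m.
Proof.
rewrite /tree_weight /= expr0 mulr1 /pprod; congr (_ / _).
by apply: eq_bigr => j _; rewrite /nslots /= big_nil addn0 expr1.
Qed.

Lemma attach_root m r :
  attach m (fun=> r) (Node [::]) = Node (nseq r (branch m)).
Proof. by rewrite /attach -/(graft _ _ _ _) graft_Node. Qed.

Lemma nattached_root m r : nattached m (fun=> r) (Node [::]) = r.
Proof. by rewrite /nattached arcsum_Node big_ord_recl !big_ord0 !addn0. Qed.

(** The case of a single stage: branches of maximal size, attached to a root
which is alone. *)
Lemma tree_weight_nseq m r : (0 < m)%N ->
  max_gen_law q m * geom_pos (q m) r.+1 = W m (Node (nseq r.+1 (branch m))).
Proof.
move=> m0; rewrite -attach_root tree_weight_attach // nattached_root.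
rewrite tree_weight_root (max_gen_lawE lambda_gt0 lambda_le qE).
rewrite /nslots /= big_nil addn0 expr1 /geom expr0 mulr1.
have := q_lt1 lambda_gt0 lambda_le qE m0 => q1.
have p0 : pprod q m != 0 by rewrite gt_eqF // (pprod_gt0 lambda_gt0 lambda_le qE).
by field; rewrite p0 subr_eq0 gt_eqF.
Qed.

End Weights.

Lemma measurable_RV_eq d (Omega : measurableType d) (R : realType)
    (P : probability Omega R) (X : {RV P >-> nat}) (n : nat) :
  measurable [set w | X w = n].
Proof. exact: (@measurable_funPTI _ _ _ _ X [set n]). Qed.

Lemma measurable_RV_seq d (Omega : measurableType d) (R : realType)
    (P : probability Omega R) (I : eqType) (X : I -> {RV P >-> nat})
    (s : seq I) (n : I -> nat) :
  measurable [set w | forall i, i \in s -> X i w = n i].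
Proof.
elim: s => [|i s IH].
  by rewrite [X in measurable X](_ : _ = setT) //; apply/seteqP; split.
rewrite [X in measurable X](_ : _ =
  [set w | X i w = n i] `&` [set w | forall i, i \in s -> X i w = n i]).
  by apply: measurableI => //; exact: measurable_RV_eq.
apply/seteqP; split => w /= H.
  by split=> [|j js]; apply: H; rewrite inE ?eqxx ?js ?orbT.
by case: H => Hi H j; rewrite inE => /predU1P[->//|]; exact: H.
Qed.

(** * The law of the constructed tree *)

Section TreeLaw.
Variables (R : realType) (lambda : R) (q : nat -> R).
Hypothesis lambda_gt0 : 0 < lambda.
Hypothesis lambda_le : lambda <= 1 / 2.
Let x := lambda * (1 - lambda).
Hypothesis q0 : q 0%N = 0.
Hypothesis qE : forall k, (0 < k)%N -> q k = 1 - x ^+ k / slot_prod q k.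
Local Notation W := (tree_weight lambda q).
Variables (d : measure_display) (Omega : measurableType d).
Variables (P : probability Omega R) (M B : {RV P >-> nat}).
Variables (C : nat -> slot -> {RV P >-> nat}) (Tr : nat -> Omega -> tree).
Hypothesis cons : construction q M B C Tr.

Lemma Tr_pruned w k : (0 < k <= M w)%N -> root_pruned k (Tr k w).
Proof.
move=> /andP[k0 kM]; have [i] : exists i, (k + i = M w)%N.
  by exists (M w - k)%N; lia.
elim: i k k0 {kM} => [|i IH] k k0 ik.
  rewrite (_ : k = M w); last by lia.
  rewrite (Tr_max cons) => [v /=|]; last by lia.
  by rewrite mem_nseq => /andP[_ /eqP->]; exact: pruned_branch.
rewrite (Tr_step cons); last by lia.
by apply: root_pruned_attach => //; apply: IH; lia.
Qed.

(** The tree has height [m + 1] almost surely given [M = m], since the number of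
[m]-branches is positive with conditional probability one. *)
Let bound (k m : nat) (T : tree) : R :=
  if height T == m.+1 then W k T else 0.

Let bound_ge0 k m T : 0 <= bound k m T.
Proof. by rewrite /bound; case: ifP => // _; exact: tree_weight_ge0. Qed.

Lemma law_Tr_max m T : (0 < m)%N ->
  measurable [set w | M w = m /\ Tr m w = T] /\
  (P [set w | M w = m /\ Tr m w = T] <= (bound m m T)%:E)%E.
Proof.
move=> m0.
have TrE w : M w = m -> Tr m w = Node (nseq (B w) (branch m)).
  by move=> Mm; move: m0; rewrite -Mm; exact: (Tr_max cons).
have [[r ->]|H] := pselect (exists r, T = Node (nseq r (branch m))).
  have -> : [set w | M w = m /\ Tr m w = Node (nseq r (branch m))] =
            [set w | M w = m /\ B w = r].
    apply/seteqP; split => w /= [Mm]; rewrite TrE //.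
      by case=> /(congr1 size); rewrite !size_nseq.
    by move=> ->.
  split; first by apply: measurableI; exact: measurable_RV_eq.
  rewrite (law_B cons) // (law_M cons) -EFinM lee_fin.
  case: r => [|r]; first by rewrite mulr0.
  rewrite /bound height_Node big_nseq ifT.
    by rewrite (tree_weight_nseq lambda_gt0 lambda_le qE).
  rewrite height_branch //; apply/eqP; congr _.+1.
  by elim: r => [|r IH]; [rewrite /= maxn0 | rewrite iterS IH maxnn].
have -> : [set w | M w = m /\ Tr m w = T] = set0.
  rewrite -subset0 => w /= [Mm TE]; apply: H; exists (B w).
  by rewrite -TE TrE.
by split => //; rewrite measure0 lee_fin.
Qed.

(** By [attach_inj], obtaining [T] after attaching the [k]-branches determines
the previous tree and the number of branches in each slot, which makes the event
an intersection to which the conditional independence applies. The same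
description gives the measurability of the event. *)
Lemma law_Tr_step m k T : (0 < k < m)%N ->
  (forall t, measurable [set w | M w = m /\ Tr k.+1 w = t] /\
    (P [set w | M w = m /\ Tr k.+1 w = t] <= (bound k.+1 m t)%:E)%E) ->
  measurable [set w | M w = m /\ Tr k w = T] /\
  (P [set w | M w = m /\ Tr k w = T] <= (bound k m T)%:E)%E.
Proof.
move=> km IH; have /andP[k0 ltkm] := km.
have [[t [n [tP TE]]]|H] :=
  pselect (exists t n, root_pruned k.+1 t /\ T = attach k n t).
  have -> : [set w | M w = m /\ Tr k w = T] =
      [set w | M w = m /\ Tr k.+1 w = t] `&`
      [set w | forall s, s \in kslots k t -> C k s w = n s].
    apply/seteqP; split => w /= [Mm].
      rewrite (Tr_step cons) ?Mm // TE => /attach_inj[] //.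
        by apply: Tr_pruned; rewrite Mm.
      by move=> Trt nE; split=> // s; rewrite mem_kslots -Trt => /nE.
    move=> CE; case: Mm => Mm Trt; split => //.
    rewrite (Tr_step cons) ?Mm // Trt TE; apply: eq_attach => s.
    by rewrite -mem_kslots; exact: CE.
  have [mt Pt] := IH t.
  split; first by apply: measurableI => //; exact: measurable_RV_seq.
  rewrite (law_C cons) //; last 2 first.
  - exact: kslots_uniq.
  - by move=> s /=; rewrite mem_kslots.
  have prod0 : 0 <= \prod_(s <- kslots k t) geom (q k) (n s).
    have qk1 := q_lt1 lambda_gt0 lambda_le qE k0.
    have qk0 := q_gt0 lambda_gt0 lambda_le qE k0.
    by apply: prodr_ge0 => s _; rewrite mulr_ge0 ?exprn_ge0 ?ltW // subr_gt0.
  apply: (@le_trans _ _ ((bound k.+1 m t)%:E *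
    (\prod_(s <- kslots k t) geom (q k) (n s))%:E)%E).
    by apply: lee_wpmul2r => //; rewrite lee_fin.
  rewrite -EFinM lee_fin {1}/bound; case: eqP => [ht|_]; last by rewrite mul0r.
  rewrite /bound TE height_attach //; last by rewrite ht ltnW.
  rewrite ht eqxx (tree_weight_attach lambda_gt0 lambda_le qE) //.
  by rewrite prod_geom_kslots.
have -> : [set w | M w = m /\ Tr k w = T] = set0.
  rewrite -subset0 => w /= [Mm TE]; apply: H.
  exists (Tr k.+1 w), (fun s => C k s w); split; last by rewrite -(Tr_step cons) ?Mm.
  by apply: Tr_pruned; rewrite Mm.
by split => //; rewrite measure0 lee_fin.
Qed.

Lemma law_Tr m k T : (0 < k <= m)%N ->
  measurable [set w | M w = m /\ Tr k w = T] /\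
  (P [set w | M w = m /\ Tr k w = T] <= (bound k m T)%:E)%E.
Proof.
move=> /andP[k0 km]; move: T; have [i ik] : exists i, (k + i = m)%N.
  by exists (m - k)%N; lia.
elim: i k k0 km ik => [|i IH] k k0 km ik T.
  by rewrite -ik addn0; apply: law_Tr_max.
by apply: law_Tr_step; [lia | apply: IH; lia].
Qed.

Lemma law_Tr1_max_gen m T :
  measurable [set w | M w = m /\ Tr 1 w = T] /\
  (P [set w | M w = m /\ Tr 1 w = T] <= (bound 1 m T)%:E)%E.
Proof.
case: m => [|m]; last by apply: law_Tr.
have [->|T0] := pselect (T = Node [::]).
  have -> : [set w | M w = 0%N /\ Tr 1 w = Node [::]] = [set w | M w = 0%N].
    apply/seteqP; split => w /= => [[]//|Mw]; split=> //.
    exact: (Tr_root cons).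
  split; first exact: measurable_RV_eq.
  rewrite (law_M cons) lee_fin /bound eqxx tree_weight_root.
  by rewrite (max_gen_lawE lambda_gt0 lambda_le qE) q0 subr0 mul1r.
have -> : [set w | M w = 0%N /\ Tr 1 w = T] = set0.
  by rewrite -subset0 => w /= [/(Tr_root cons)-> /esym].
by split => //; rewrite measure0 lee_fin.
Qed.

(** Only the event on which the maximal generation is [height T - 1] contributes. *)
Lemma law_Tr1 T :
  measurable [set w | Tr 1 w = T] /\
  (P [set w | Tr 1 w = T] <= (W 1 T)%:E)%E.
Proof.
set E := fun m => [set w | M w = m /\ Tr 1 w = T].
have mE m : measurable (E m) by case: (law_Tr1_max_gen m T).
have TE : [set w | Tr 1 w = T] = \bigcup_m E m.
  by apply/seteqP; split => w /= => [Tw|[m _ []]//]; exists (M w).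
split; first by rewrite TE; exact: bigcupT_measurable.
set m0 := (height T).-1.
pose F m := if m == m0 then set0 else E m.
have mF m : measurable (F m) by rewrite /F; case: ifP.
have F0 : P (\bigcup_m F m) = 0%E.
  apply: measure_negligible; first exact: bigcupT_measurable.
  apply: negligible_bigcup => m; apply/negligibleP => //.
  rewrite /F; case: eqP => mm0; first by rewrite measure0.
  apply/eqP; rewrite eq_le measure_ge0 andbT.
  case: (law_Tr1_max_gen m T) => _; rewrite /bound; case: eqP => // hm.
  by case: mm0; rewrite /m0 hm.
have -> : [set w | Tr 1 w = T] = E m0 `|` \bigcup_m F m.
  rewrite TE; apply/seteqP; split => w /=.
    move=> [m _ Em]; have [mm|mm] := eqVneq m m0; first by left; rewrite -mm.
    by right; exists m => //; rewrite /F (negPf mm).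
  by move=> [Em|[m _]]; [exists m0|rewrite /F; case: ifP => // _ Em; exists m].
apply: (le_trans (measureU2 _ _ _)) => //; first exact: bigcupT_measurable.
rewrite [X in (_ + X)%E](_ : _ = 0%E) ?adde0 //; case: (law_Tr1_max_gen m0 T) => _ /le_trans; apply.
rewrite lee_fin /bound; case: ifP => // _; exact: tree_weight_ge0.
Qed.

End TreeLaw.

(** * The genealogical tree *)

Lemma genealogy_rcons (f : seq nat -> nat) u i :
  genealogy f (rcons u i) <-> genealogy f u /\ (i < f u)%N.
Proof.
split=> [H|[H iu] j].
  split=> [j ju|].
    have := H j; rewrite size_rcons nth_rcons ju -cats1 takel_cat ?(ltnW ju) //.
    by apply; rewrite ltnS (ltnW ju).
  have := H (size u); rewrite size_rcons nth_rcons ltnn eqxx -cats1 take_size_cat //.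
  exact.
rewrite size_rcons ltnS leq_eqVlt => /predU1P[->|ju].
  by rewrite nth_rcons ltnn eqxx -cats1 take_size_cat.
by rewrite nth_rcons ju -cats1 takel_cat ?(ltnW ju) //; exact: H.
Qed.

Lemma subtree_rcons t u i :
  isSome (subtree t (rcons u i)) = isSome (subtree t u) && (i < arity t u)%N.
Proof.
elim: u t => [|j u IH] [ts]; first by rewrite subtree_Node; case: ltnP.
rewrite rcons_cons !subtree_Node; case: ltnP => // jS.
by rewrite IH arity_Node.
Qed.

Lemma genealogyP (f : seq nat -> nat) t :
  genealogy f = nodes t <-> (forall u, u \in addrs t -> f u = arity t u).
Proof.
split=> [E u|H].
  rewrite mem_addrs => ut; have gu : genealogy f u by rewrite E.
  have step i : (i < f u)%N = (i < arity t u)%N.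
    have : genealogy f (rcons u i) <-> nodes t (rcons u i) by rewrite E.
    rewrite genealogy_rcons /nodes /= subtree_rcons ut /= => -[h1 h2].
    by apply/idP/idP => [iu|/h2[]//]; exact: h1.
  have [lt|gt|//] := ltngtP (f u) (arity t u).
    by have := step (f u); rewrite lt ltnn.
  by have := step (arity t u); rewrite gt ltnn.
apply/seteqP; split; elim/last_ind => [//|u i IH].
  move/genealogy_rcons => [/IH ut iu].
  by rewrite /nodes /= subtree_rcons ut /= -H // mem_addrs.
rewrite /nodes /= subtree_rcons => /andP[ut iu].
by apply/genealogy_rcons; split; [exact: IH | rewrite H ?mem_addrs].
Qed.

Lemma arity_inj t t' : (forall u, u \in addrs t -> arity t' u = arity t u) ->
  t = t'.
Proof.
elim/tree_ind_nth: t t' => ts IH [ts'] H.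
have sE : size ts = size ts' by symmetry; apply: (H [::]); rewrite addrs_Node mem_head.
congr Node; apply: (@eq_from_nth _ (Node [::])) => // i iS; apply: IH => // u ui.
have := H (i :: u); rewrite mem_addrs subtree_Node iS -mem_addrs ui.
by rewrite !arity_Node -?sE // => ->.
Qed.

Lemma nodes_inj : injective nodes.
Proof.
move=> t t' E; apply: arity_inj => u ut.
have /genealogyP H : genealogy (arity t') = nodes t.
  by rewrite E; apply/genealogyP.
exact: H.
Qed.

(** A tree with [e] edges has [e + 1] nodes, whose numbers of children add up
to [e]. *)
Lemma genealogy_law (R : realType) (lambda : R) (q : nat -> R) d
    (Omega : measurableType d) (P : probability Omega R)
    (N : seq nat -> {RV P >-> nat}) t :
  iid_given setT setT N (geom (1 - lambda)) ->
  measurable [set w | genealogy (fun u => N u w) = nodes t] /\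
  P [set w | genealogy (fun u => N u w) = nodes t] =
    (tree_weight lambda q 1 t)%:E.
Proof.
move=> iidN.
have -> : [set w | genealogy (fun u => N u w) = nodes t] =
    [set w | forall u, u \in addrs t -> N u w = arity t u].
  by apply/seteqP; split => w /= /genealogyP.
split; first exact: measurable_RV_seq.
have := iidN (addrs t) (arity t) (addrs_uniq t) (@subsetT _ _).
rewrite setTI probability_setT mul1e => ->; congr EFin.
rewrite /geom big_split /= big_const_seq count_predT size_addrs iter_mulr_1.
rewrite subKr (_ : \prod_(u <- _) _ = lambda ^+ edges t); last first.
  rewrite -sum_arity; elim/big_rec2: _ => [|u y1 y2 _ ->]; first by rewrite expr0.
  by rewrite exprD.
by rewrite /tree_weight big_geq // divr1 exprMn exprS; ring.
Qed.

(** * Comparison of the two laws *)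

(** [Y w] is a random tree that may fail to exist, such as a genealogical tree
that may be infinite. *)
Lemma measure_tree_le d d' (Omega : measurableType d) (Omega' : measurableType d')
    (R : realType) (P : probability Omega R) (P' : probability Omega' R)
    (X : Omega -> tree) (Y : Omega' -> tree -> Prop) :
  (forall t, measurable [set w | X w = t]) ->
  (forall t, measurable [set w | Y w t]) ->
  (forall w t t', Y w t -> Y w t' -> t = t') ->
  (forall t, P [set w | X w = t] <= P' [set w | Y w t])%E ->
  forall A : set tree,
    [/\ measurable [set w | A (X w)], measurable [set w | exists2 t, A t & Y w t]
      & (P [set w | A (X w)] <= P' [set w | exists2 t, A t & Y w t])%E].
Proof.
move=> mX mY Yinj XY A.
pose S n := [set t | A t /\ pickle t = n].
have S1 n : S n = set0 \/ exists t, S n = [set t].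
  have [[t [At tn]]|H] := pselect (exists t, S n t).
    right; exists t; apply/seteqP; split => [t' [_ t'n]|_ ->//].
    by apply: (pcan_inj pickleK); rewrite tn t'n.
  by left; rewrite -subset0 => t tn; apply: H; exists t.
pose F n := [set w | S n (X w)]; pose G n := [set w | exists2 t, S n t & Y w t].
have FE : [set w | A (X w)] = \bigcup_n F n.
  by apply/seteqP; split => w /= => [Aw|[n _ []]//]; exists (pickle (X w)).
have GE : [set w | exists2 t, A t & Y w t] = \bigcup_n G n.
  apply/seteqP; split => w /= => [[t At Yt]|[n _ [t [At _] Yt]]]; last by exists t.
  by exists (pickle t) => //; exists t.
have FG n : [/\ measurable (F n), measurable (G n) & (P (F n) <= P' (G n))%E].
  have [S0|[t St]] := S1 n.
    have -> : F n = set0 by rewrite /F S0.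
    have -> : G n = set0 by rewrite /G S0 -subset0 => w [].
    by split => //; rewrite !measure0.
  have -> : F n = [set w | X w = t] by rewrite /F St.
  have -> : G n = [set w | Y w t].
    by rewrite /G St; apply/seteqP; split => w /= => [[_ ->]//|]; exists t.
  by split.
have mF n : measurable (F n) by case: (FG n).
have mG n : measurable (G n) by case: (FG n).
rewrite FE GE; split; [exact: bigcupT_measurable..|].
rewrite !measure_bigcup //; last 2 first.
- by move=> n m _ _ [w [[t [_ <-] Yt] [t' [_ <-] Yt']]]; rewrite (Yinj w t t').
- by move=> n m _ _ [w [[_ <-] [_ <-]]].
apply: lee_nneseries => n _ *; first exact: measure_ge0.
by case: (FG n).
Qed.

(** Adding the inequality for the complement of [A] gives at most one on the
right and exactly one on the left, so that both inequalities are equalities. *)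
Lemma law_eq_of_le d d' (Omega : measurableType d) (Omega' : measurableType d')
    (R : realType) (P : probability Omega R) (P' : probability Omega' R)
    (X : Omega -> tree) (Y : Omega' -> tree -> Prop) :
  (forall t, measurable [set w | X w = t]) ->
  (forall t, measurable [set w | Y w t]) ->
  (forall w t t', Y w t -> Y w t' -> t = t') ->
  (forall t, P [set w | X w = t] <= P' [set w | Y w t])%E ->
  forall A : set tree, P [set w | A (X w)] = P' [set w | exists2 t, A t & Y w t].
Proof.
move=> mX mY Yinj XY A.
have [mA mA' leA] := measure_tree_le mX mY Yinj XY A.
have [mC mC' leC] := measure_tree_le mX mY Yinj XY (~` A).
apply/eqP; rewrite eq_le leA /=.
have PC : (P [set w | (~` A) (X w)] = 1 - P [set w | A (X w)])%E.
  by rewrite -probability_setC.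
have P'C : (P' [set w | exists2 t, (~` A) t & Y w t] <=
    1 - P' [set w | exists2 t, A t & Y w t])%E.
  rewrite -probability_setC // le_measure ?inE //; first exact: measurableC.
  by move=> w /= [t At Yt] [t' At' Yt']; apply: At; rewrite (Yinj w t t').
have := le_trans leC P'C; rewrite PC.
rewrite -(fineK (fin_num_measure P _ mA)) -(fineK (fin_num_measure P' _ mA')).
by rewrite -!EFinB !lee_fin; lra.
Qed.

Theorem mainTheorem4 (R : realType) (lambda : R) (q : nat -> R)
    (lambda_gt0 : 0 < lambda) (lambda_le : lambda <= 1 / 2)
    (q0 : q 0%N = 0)
    (q1 : q 1%N = 1 - lambda * (1 - lambda))
    (qk : forall k : nat, (2 <= k)%N ->
       q k = 1 - (lambda * (1 - lambda)) ^+ k /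
                 \prod_(1 <= j < k) q j ^+ (2 * (k - j))%N) :
  [/\ (* the laws used in the construction are well defined *)
      forall k : nat, (0 < k)%N -> 0 < q k < 1,
      (forall m : nat, 0 <= max_gen_law q m) /\
      (\sum_(0 <= m <oo) (max_gen_law q m)%:E = 1)%E
    & (* the tree obtained is a branching process *)
      forall (d : measure_display) (Omega : measurableType d)
             (P : probability Omega R)
             (M B : {RV P >-> nat}) (C : nat -> slot -> {RV P >-> nat})
             (Tr : nat -> Omega -> tree)
             (d' : measure_display) (Omega' : measurableType d')
             (P' : probability Omega' R) (N : seq nat -> {RV P' >-> nat}),
        construction q M B C Tr ->
        iid_given setT setT N (geom (1 - lambda)) ->
        forall A : set tree,
          P [set w | A (Tr 1%N w)] =
          P' [set w | exists2 t : tree, A t &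
                        genealogy (fun u => N u w) = nodes t]].
Proof.
have qE k : (0 < k)%N -> q k = 1 - (lambda * (1 - lambda)) ^+ k / slot_prod q k.
  case: k => [//|[_|k _]]; last exact: qk.
  by rewrite q1 /slot_prod big_geq // expr1 divr1.
split.
- by move=> k k0; rewrite (q_gt0 lambda_gt0 lambda_le qE) // (q_lt1 lambda_gt0 lambda_le qE).
- split=> [m|]; first exact: (max_gen_law_ge0 lambda_gt0 lambda_le qE).
  exact: (sum_max_gen_law lambda_gt0 lambda_le qE).
move=> d Omega P M B C Tr d' Omega' P' N cons iidN.
have law t := law_Tr1 lambda_gt0 lambda_le q0 qE cons t.
have gen t := genealogy_law q t iidN.
apply: law_eq_of_le => [t|t|w t t' -> /nodes_inj//|t].
- by case: (law t).
- by case: (gen t).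
- by case: (gen t) => _ ->; case: (law t).
Qed.
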